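(* Let $\{f_i\}_{i\in\mathbb{N}}$ be an infinite set of linearly independent elements of a Hilbert space $H$ and let $\{e_i\}_{i\in\mathbb{N}}$ be an orthonormal basis of $l_2$. Suppose that the linear operator $F:l_2\to H$ determined by $F(e_i)=f_i$ for $i\in\mathbb{N}$ is bounded. (1) If $I-|F|$ is Hilbert-Schmidt, then $\sum_{j=1}^\infty\|\mu_j-f_j\|^2\ge\|I-|F|\|_{c_2}^2$ for all orthonormal subsets $\{\mu_i\}_{i\in\mathbb{N}}$ of $H$. (2) If $\sum_{j=1}^\infty\|\mu_j-f_j\|^2<\infty$ for some orthonormal set $\{\mu_i\}_{i\in\mathbb{N}}$ in $H$, then the operator $I-|F|$ is Hilbert-Schmidt and the estimate $\sum_{j=1}^\infty\|\mu_j-f_j\|^2\ge\|I-|F|\|_{c_2}^2$ is valid.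
   Context: Hilbert spaces are complex. Linear independence means that every finite subfamily is linearly independent. $|F|=(F^*F)^{1/2}$ acts on $l_2$, $I$ is the identity on $l_2$, and $\|\cdot\|_{c_2}$ is the Hilbert-Schmidt norm. Sums of nonnegative terms may be $+\infty$. *)

(* Defs.v *)
From HB Require Import structures.
From mathcomp Require Import all_boot all_order all_algebra.
From mathcomp Require Import sesquilinear complex ring lra.
From mathcomp Require Import boolp classical_sets functions reals ereal.
From mathcomp Require Import topology normedtype sequences.

Set Implicit Arguments.
Unset Strict Implicit.
Unset Printing Implicit Defensive.

Import Order.TTheory GRing.Theory Num.Theory.
Import numFieldNormedType.Exports.

Local Open Scope classical_set_scope.
Local Open Scope complex_scope.
Local Open Scope ring_scope.

(* Inner products are linear in the first argument and conjugate-linear in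
   the second one. *)
HB.mixin Record NormedModule_isInnerProduct (R : realType) H
    & NormedModule R[i] H := {
  inner : {dot H for @Num.conj R[i]} ;
  sqr_norm_inner : forall x : H, `|x| ^+ 2 = inner x x
}.

#[short(type="innerProductType")]
HB.structure Definition InnerProduct (R : realType) :=
  {H of NormedModule R[i] H & NormedModule_isInnerProduct R H}.

#[short(type="hilbertType")]
HB.structure Definition Hilbert (R : realType) :=
  {H of InnerProduct R H & Complete H}.

(* The norm of a normed module over R[i] takes its values in R[i]; [rnorm] is
   the same norm as an element of R. *)
Definition rnorm (R : realType) (V : normedZmodType R[i]) (x : V) : R :=
  complex.Re `|x|.

Section rnorm_theory.
Variables (R : realType).
Implicit Types (V : normedZmodType R[i]) (z w : R[i]).

Lemma rnormE V (x : V) : (rnorm x)%:C = `|x|.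
Proof. by rewrite /rnorm RRe_real// ger0_real. Qed.

Lemma rnorm_ge0 V (x : V) : 0 <= rnorm x.
Proof. by rewrite -ler0c rnormE. Qed.

Lemma ler_rnormD V (x y : V) : rnorm (x + y) <= rnorm x + rnorm y.
Proof. by rewrite -lecR rmorphD/= !rnormE ler_normD. Qed.

Lemma rnormM z w : rnorm (z * w) = rnorm z * rnorm w.
Proof. by apply: complexI; rewrite rmorphM/= !rnormE normrM. Qed.

Lemma rnorm_conj z : rnorm (Num.conj z) = rnorm z.
Proof. by apply: complexI; rewrite !rnormE norm_conjC. Qed.

Lemma sqr_rnorm z : rnorm z ^+ 2 = complex.Re z ^+ 2 + complex.Im z ^+ 2.
Proof. by apply: complexI; rewrite rmorphXn/= rnormE add_Re2_Im2. Qed.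

Lemma normr_Re_le z : `|complex.Re z| <= rnorm z.
Proof. by rewrite -lecR rnormE normc_ge_Re. Qed.

Lemma normr_Im_le z : `|complex.Im z| <= rnorm z.
Proof.
rewrite -(ler_pXn2r (n := 2))// ?nnegrE ?rnorm_ge0//.
by rewrite sqr_rnorm real_normK ?num_real// lerDr sqr_ge0.
Qed.

Lemma complexReD z w : complex.Re (z + w) = complex.Re z + complex.Re w.
Proof. by case: z w => [? ?] []. Qed.

Lemma complexImD z w : complex.Im (z + w) = complex.Im z + complex.Im w.
Proof. by case: z w => [? ?] []. Qed.

Lemma complexReB z w : complex.Re (z - w) = complex.Re z - complex.Re w.
Proof. by case: z w => [? ?] []. Qed.

Lemma complexImB z w : complex.Im (z - w) = complex.Im z - complex.Im w.
Proof. by case: z w => [? ?] []. Qed.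

Lemma complexReM z w : complex.Re (z * w) =
  complex.Re z * complex.Re w - complex.Im z * complex.Im w.
Proof. by case: z w => [? ?] []. Qed.

Lemma complexImM z w : complex.Im (z * w) =
  complex.Re z * complex.Im w + complex.Im z * complex.Re w.
Proof. by case: z w => [? ?] []. Qed.

Lemma conjcE z : Num.conj z = (complex.Re z) -i* (complex.Im z).
Proof. by case: z. Qed.

End rnorm_theory.

(* Sum of a complex series, absolutely convergent in every use below. *)
Section csum.
Variable R : realType.
Implicit Types (z w : nat -> R[i]) (a : R[i]).

Definition abs_summable z := cvgn (series (fun k => rnorm (z k))).

Definition csum z : R[i] :=
  limn (series (fun k => complex.Re (z k))) +i*
  limn (series (fun k => complex.Im (z k))).

Lemma abs_summable_Re z : abs_summable z ->
  cvgn (series (fun k => complex.Re (z k))).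
Proof.
move=> sz; apply: normed_cvg.
apply: (series_le_cvg _ _ _ sz) => n //=; first exact: rnorm_ge0.
exact: normr_Re_le.
Qed.

Lemma abs_summable_Im z : abs_summable z ->
  cvgn (series (fun k => complex.Im (z k))).
Proof.
move=> sz; apply: normed_cvg.
apply: (series_le_cvg _ _ _ sz) => n //=; first exact: rnorm_ge0.
exact: normr_Im_le.
Qed.

Lemma csumD z w : abs_summable z -> abs_summable w ->
  csum (fun k => z k + w k) = csum z + csum w.
Proof.
move=> sz sw; rewrite /csum.
have -> : (fun k => complex.Re (z k + w k)) =
    (fun k => complex.Re (z k)) + (fun k => complex.Re (w k)).
  by apply/funext => k; rewrite complexReD.
have -> : (fun k => complex.Im (z k + w k)) =
    (fun k => complex.Im (z k)) + (fun k => complex.Im (w k)).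
  by apply/funext => k; rewrite complexImD.
rewrite lim_seriesD; [|exact: abs_summable_Re..].
by rewrite lim_seriesD; [|exact: abs_summable_Im..].
Qed.

Lemma csumZ a z : abs_summable z -> csum (fun k => a * z k) = a * csum z.
Proof.
move=> sz; rewrite /csum.
have cr := abs_summable_Re sz; have ci := abs_summable_Im sz.
have -> : (fun k => complex.Re (a * z k)) =
    complex.Re a *: (fun k => complex.Re (z k)) -
    complex.Im a *: (fun k => complex.Im (z k)).
  by apply/funext => k; rewrite complexReM.
have -> : (fun k => complex.Im (a * z k)) =
    complex.Re a *: (fun k => complex.Im (z k)) +
    complex.Im a *: (fun k => complex.Re (z k)).
  by apply/funext => k; rewrite complexImM.
rewrite lim_seriesB; [|exact: is_cvg_seriesZ..].
rewrite lim_seriesD; [|exact: is_cvg_seriesZ..].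
rewrite !lim_seriesZ//.
by apply/eqP; rewrite eq_complex complexReM complexImM/= !eqxx.
Qed.

Lemma csum_conj z : abs_summable z ->
  csum (fun k => Num.conj (z k)) = Num.conj (csum z).
Proof.
move=> sz; rewrite conjcE /csum/=.
have -> : (fun k => complex.Re (Num.conj (z k))) = (fun k => complex.Re (z k)).
  by apply/funext => k; rewrite conjcE.
have -> : (fun k => complex.Im (Num.conj (z k))) =
    - (fun k => complex.Im (z k)).
  by apply/funext => k; rewrite conjcE.
by rewrite lim_seriesN//; exact: abs_summable_Im.
Qed.

End csum.

Section l2_def.
Variable R : realType.
Implicit Types (u v : nat -> R[i]).

Definition square_summable : {pred nat -> R[i]} :=
  [pred u : nat -> R[i] | `[< cvgn (series (fun k => rnorm (u k) ^+ 2)) >]].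

Lemma square_summableP u :
  reflect (cvgn (series (fun k => rnorm (u k) ^+ 2))) (u \in square_summable).
Proof. exact: asboolP. Qed.

Lemma square_summable_submod_closed : submod_closed square_summable.
Proof.
split.
  apply/square_summableP; rewrite (_ : series _ = cst 0).
    exact: is_cvg_cst.
  apply/funext => n; rewrite /series/= big1// => k _.
  by rewrite /rnorm normr0/= expr0n.
move=> a u v /square_summableP su /square_summableP sv.
apply/square_summableP.
apply: (@series_le_cvg _ _ ((2 * rnorm a ^+ 2) *: (fun k => rnorm (u k) ^+ 2) +
    2 *: (fun k => rnorm (v k) ^+ 2))).
- by move=> k; exact: sqr_ge0.
- by move=> k; rewrite addr_ge0// mulr_ge0// ?sqr_ge0// mulr_ge0 ?sqr_ge0.
- move=> k; apply: (@le_trans _ _ ((rnorm a * rnorm (u k) + rnorm (v k)) ^+ 2)).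
    rewrite ler_pXn2r// ?nnegrE ?rnorm_ge0 ?addr_ge0 ?mulr_ge0 ?rnorm_ge0//.
    by rewrite -rnormM ler_rnormD.
  rewrite -[leRHS]/((2 * rnorm a ^+ 2) * (rnorm (u k) ^+ 2) +
    2 * (rnorm (v k) ^+ 2)).
  by have := sqr_ge0 (rnorm a * rnorm (u k) - rnorm (v k)); nra.
- by apply: is_cvg_seriesD; exact: is_cvg_seriesZ.
Qed.

HB.instance Definition _ := GRing.isSubmodClosed.Build _ _ square_summable
  square_summable_submod_closed.

Record l2 := L2 { l2_val :> nat -> R[i] ; _ : l2_val \in square_summable }.

HB.instance Definition _ := [isSub for l2_val].
HB.instance Definition _ := [Choice of l2 by <:].
HB.instance Definition _ := [SubChoice_isSubLmodule of l2 by <:].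

Implicit Types x y : l2.

Lemma l2P x : cvgn (series (fun k => rnorm (x k) ^+ 2)).
Proof. by apply/square_summableP; case: x. Qed.

Lemma l2D x y k : (x + y) k = x k + y k.
Proof. by []. Qed.

Lemma l2B x y k : (x - y) k = x k - y k.
Proof. by []. Qed.

Lemma l2Z a x k : (a *: x) k = a * x k.
Proof. by []. Qed.

Definition l2_inner x y : R[i] := csum (fun k => x k * Num.conj (y k)).

Lemma l2_inner_summable x y : abs_summable (fun k => x k * Num.conj (y k)).
Proof.
apply: (@series_le_cvg _ _ ((fun k => rnorm (x k) ^+ 2) +
    (fun k => rnorm (y k) ^+ 2))).
- by move=> k; exact: rnorm_ge0.
- by move=> k; rewrite addr_ge0// sqr_ge0.
- move=> k; rewrite rnormM rnorm_conj.
  rewrite -[leRHS]/(rnorm (x k) ^+ 2 + rnorm (y k) ^+ 2).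
  have := sqr_ge0 (rnorm (x k) - rnorm (y k)).
  by have := rnorm_ge0 (x k); have := rnorm_ge0 (y k); nra.
- by apply: is_cvg_seriesD; exact: l2P.
Qed.

Lemma l2_innerC x y : l2_inner x y = Num.conj (l2_inner y x).
Proof.
rewrite /l2_inner -csum_conj; last exact: l2_inner_summable.
by congr csum; apply/funext => k; rewrite rmorphM/= conjCK mulrC.
Qed.

Lemma l2_inner_linear y : linear_for *%R (l2_inner^~ y).
Proof.
move=> a x x'; rewrite /l2_inner -csumZ; last exact: l2_inner_summable.
rewrite -csumD; [| |exact: l2_inner_summable]; last first.
  have := @l2_inner_summable (a *: x) y; congr abs_summable.
  by apply/funext => k; rewrite l2Z mulrA.
by congr csum; apply/funext => k; rewrite l2D l2Z mulrDl mulrA.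
Qed.

Lemma l2_inner_bilinear :
  bilinear_for *%R (Num.conj \; *%R) l2_inner.
Proof.
split => [y|x] a u v; first exact: l2_inner_linear.
rewrite l2_innerC l2_inner_linear rmorphD rmorphM/=.
by rewrite -!l2_innerC.
Qed.

Lemma l2_innerxx x :
  l2_inner x x = (limn (series (fun k => rnorm (x k) ^+ 2)))%:C.
Proof.
rewrite /l2_inner /csum.
have -> : (fun k => complex.Re (x k * Num.conj (x k))) =
    (fun k => rnorm (x k) ^+ 2).
  by apply/funext => k; rewrite sqr_rnorm complexReM conjcE/= mulrN opprK -!expr2.
have -> : (fun k => complex.Im (x k * Num.conj (x k))) = cst 0.
  by apply/funext => k; rewrite complexImM conjcE/= mulrN mulrC addNr.
have -> : series (cst 0) = cst (0 : R).
  by apply/funext => n; rewrite /series/= big1.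
by rewrite lim_cst.
Qed.

Lemma l2_sum_le x n :
  \sum_(k < n) rnorm (x k) ^+ 2 <= complex.Re (l2_inner x x).
Proof.
rewrite l2_innerxx/= -(big_mkord xpredT (fun k => rnorm (x k) ^+ 2)).
apply: (nondecreasing_cvgn_le (u_ := series (fun k => rnorm (x k) ^+ 2))).
  by apply: nondecreasing_series => k _ _; exact: sqr_ge0.
exact: l2P.
Qed.

Lemma l2_inner_gt0 x : x != 0 -> 0 < l2_inner x x.
Proof.
move=> x0; have [k xk0] : exists k, x k != 0.
  apply: contrapT => /forallNP xk0; move/eqP: x0; apply.
  apply/val_inj/funext => k /=.
  by have /negP/negPn/eqP := xk0 k.
suff : 0 < complex.Re (l2_inner x x) by rewrite l2_innerxx ltcR.
apply: lt_le_trans (l2_sum_le x k.+1).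
rewrite big_ord_recr/= ltr_wpDl ?sumr_ge0// => [i _|]; first exact: sqr_ge0.
rewrite exprn_gt0// lt_neqAle rnorm_ge0 andbT eq_sym.
by apply: contra_neq xk0 => /(congr1 (real_complex R))/=; rewrite rnormE => /normr0_eq0.
Qed.

End l2_def.

Section dot_theory.
Variables (C : numClosedFieldType) (U : lmodType C).
Variable form : {dot U for @Num.conj C}.

Lemma dot_CauchySchwarz (u v : U) :
  `|form u v| ^+ 2 <= form u u * form v v.
Proof.
have [->|v0] := eqVneq v 0; first by rewrite !linear0r normr0 expr0n mulr0.
pose c := form v v; pose d := form u v.
have c0 : 0 < c by rewrite dnorm_gt0.
have : 0 <= form (c *: u - d *: v) (c *: u - d *: v) by exact: dnorm_ge0.
rewrite dnormB !dnormZ linearZl_LR linearZr_LR/= -/c -/d.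
rewrite [d^* * d]mulrC -normCK [(c * _)^*]geC0_conj; last first.
  by rewrite mulr_ge0 ?exprn_ge0// ltW.
rewrite (gtr0_norm c0) => h; rewrite -(ler_pM2l c0) -subr_ge0.
apply: le_trans h _; rewrite le_eqVlt; apply/orP; left; apply/eqP.
by ring.
Qed.

Lemma dot_triangle (u v : U) :
  sqrtC (form (u + v) (u + v)) <= sqrtC (form u u) + sqrtC (form v v).
Proof.
have n0 w : 0 <= sqrtC (form w w) by rewrite sqrtC_ge0 dnorm_ge0.
rewrite -(ler_pXn2r (n := 2))// ?nnegrE ?addr_ge0//.
rewrite sqrrD !sqrtCK dnormD [leRHS]addrAC lerD2l.
have d_le : `|form u v| <= sqrtC (form u u) * sqrtC (form v v).
  rewrite -(ler_pXn2r (n := 2))// ?nnegrE ?mulr_ge0//.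
  by rewrite exprMn !sqrtCK dot_CauchySchwarz.
have <- : 'Re (form u v) *+ 2 = form u v + (form u v)^*.
  by rewrite ReE -[_ *+ 2]mulr_natr divfK ?pnatr_eq0.
rewrite lerMn2r/=; apply: le_trans d_le.
exact: leif_Re_Creal.
Qed.

End dot_theory.

Section l2_hilbert.
Variable R : realType.
Local Notation l2 := (l2 R).

HB.instance Definition _ := bilinear_isBilinear.Build R[i] l2 l2 R[i]
  *%R (Num.conj \; *%R) (@l2_inner R) (@l2_inner_bilinear R).

Lemma l2_inner_hermitian (x y : l2) :
  l2_inner x y = (-1) ^+ false * Num.conj (l2_inner y x).
Proof. by rewrite expr0 mul1r l2_innerC. Qed.

HB.instance Definition _ := isHermitianSesquilinear.Build R[i] l2 false
  Num.conj (@l2_inner R) l2_inner_hermitian.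

HB.instance Definition _ := isDotProduct.Build R[i] l2 (@l2_inner R)
  (@l2_inner_gt0 R).

Let dot : {dot l2 for @Num.conj R[i]} := @l2_inner R.

Definition l2_norm (x : l2) : R[i] := sqrtC (l2_inner x x).

Lemma l2_normD (x y : l2) : l2_norm (x + y) <= l2_norm x + l2_norm y.
Proof. exact: (dot_triangle dot). Qed.

Lemma l2_normZ (a : R[i]) (x : l2) : l2_norm (a *: x) = `|a| * l2_norm x.
Proof.
rewrite /l2_norm (dnormZ dot) sqrtCM ?nnegrE ?exprn_ge0//.
by rewrite sqrCK.
Qed.

Lemma l2_norm0_eq0 (x : l2) : l2_norm x = 0 -> x = 0.
Proof. by move=> /eqP; rewrite sqrtC_eq0 (dnorm_eq0 dot) => /eqP. Qed.

HB.instance Definition _ := Lmodule_isNormed.Build R[i] l2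
  l2_normD l2_normZ l2_norm0_eq0.

Lemma l2_sqr_norm (x : l2) : `|x| ^+ 2 = dot x x.
Proof. exact: sqrtCK. Qed.

HB.instance Definition _ :=
  NormedModule_isInnerProduct.Build R l2 l2_sqr_norm.

Lemma l2_coord_le (x : l2) n : \sum_(k < n) rnorm (x k) ^+ 2 <= rnorm x ^+ 2.
Proof.
apply: le_trans (l2_sum_le x n) _.
suff -> : l2_inner x x = (rnorm x ^+ 2)%:C by [].
by rewrite rmorphXn/= rnormE l2_sqr_norm.
Qed.

Lemma l2_coord1_le (x : l2) k : rnorm (x k) <= rnorm x.
Proof.
rewrite -(ler_pXn2r (n := 2))// ?nnegrE ?rnorm_ge0//.
apply: le_trans (l2_coord_le x k.+1).
by rewrite big_ord_recr/= lerDr sumr_ge0// => i _; exact: sqr_ge0.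
Qed.

Lemma l2_norm_le (x : l2) (e : R) : 0 <= e ->
  (forall n, \sum_(k < n) rnorm (x k) ^+ 2 <= e ^+ 2) -> rnorm x <= e.
Proof.
move=> e0 xe; rewrite -(ler_pXn2r (n := 2))// ?nnegrE ?rnorm_ge0//.
rewrite -lecR rmorphXn/= rnormE l2_sqr_norm [dot x x]l2_innerxx lecR.
apply: limr_le; first exact: l2P.
by apply: nearW => n; rewrite /series/= big_mkord.
Qed.

Lemma l2_complete (F : set_system l2) : ProperFilter F -> cauchy F -> cvg F.
Proof.
move=> FF /cauchy_ballP cF.
have {}cF (e : R) : 0 < e -> \forall x & y \near F, rnorm (x - y) < e.
  move=> e0; have /cF : 0 < e%:C :> R[i] by rewrite ltcR.
  by apply: filterS => -[x y]/=; rewrite -ball_normE/= -rnormE ltcR.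
have fcvg (f : l2 -> R) : (forall x y, `|f x - f y| <= rnorm (x - y)) ->
    cvg (f @ F).
  move=> fle; apply/cauchy_cvgP/cauchy_ballP => e e0.
  rewrite near_map2; apply: filterS (cF e e0) => -[x y]/= xy.
  by rewrite /ball/=; exact: le_lt_trans (fle x y) xy.
pose re k (x : l2) := complex.Re (x k).
pose im k (x : l2) := complex.Im (x k).
have re_cvg k : cvg (re k @ F).
  apply: fcvg => x y; rewrite /re -complexReB -l2B.
  exact: le_trans (normr_Re_le _) (l2_coord1_le _ _).
have im_cvg k : cvg (im k @ F).
  apply: fcvg => x y; rewrite /im -complexImB -l2B.
  exact: le_trans (normr_Im_le _) (l2_coord1_le _ _).
pose u k : R[i] := lim (re k @ F) +i* lim (im k @ F).
have dist_u (e : R) : 0 < e -> \forall x \near F,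
    forall n, \sum_(k < n) rnorm ((x : l2) k - u k) ^+ 2 <= e ^+ 2.
  move=> e0; have [[A B]/= [FA FB] AB] := cF e e0.
  near=> x; move=> n.
  pose g y := \sum_(k < n)
    ((complex.Re (x k) - re k y) ^+ 2 + (complex.Im (x k) - im k y) ^+ 2).
  have gcvg : g @ F --> \sum_(k < n) rnorm (x k - u k) ^+ 2.
    have sqr_cvg c (h : l2 -> R) : cvg (h @ F) ->
        (c - h y) ^+ 2 @[y --> F] --> (c - lim (h @ F)) ^+ 2.
      have -> : (fun y => (c - h y) ^+ 2) =
          (fun y => (c - h y) * (c - h y)) by [].
      by move=> hF; rewrite expr2; apply: cvgM; apply: cvgB => //; exact: cvg_cst.
    apply: cvg_big => [|k _]; first exact: add_continuous.
    by rewrite sqr_rnorm complexReB complexImB; apply: cvgD; exact: sqr_cvg.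
  apply: (closed_cvg (fun r => r <= e ^+ 2)) gcvg; first exact: closed_le.
  near=> y.
  have xy : rnorm (x - y) < e.
    by apply: (AB (x, y)); split => /=; [near: x|near: y].
  apply: le_trans (_ : rnorm (x - y) ^+ 2 <= _); last first.
    by rewrite ler_pXn2r// ?nnegrE ?rnorm_ge0// ltW.
  apply: le_trans (l2_coord_le (x - y) n).
  by rewrite ler_sum// => k _; rewrite sqr_rnorm l2B complexReB complexImB.
have [x0 ux0] : exists x : l2, forall n,
    \sum_(k < n) rnorm (x k - u k) ^+ 2 <= 1 ^+ 2.
  by have /filter_ex := dist_u _ ltr01.
have u0 : (fun k => x0 k - u k) \in @square_summable R.
  apply/square_summableP; apply: nondecreasing_is_cvgn.
    by apply: nondecreasing_series => k _ _; exact: sqr_ge0.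
  by exists (1 ^+ 2) => _ [n _ <-]; rewrite /series/= big_mkord.
pose v : l2 := x0 - L2 u0.
have vE k : v k = u k by rewrite /v l2B/= opprB addrC subrK.
apply/cvg_ex; exists v; apply/cvgrPdist_le => e e0.
have eE : e = (complex.Re e)%:C by rewrite RRe_real// gtr0_real.
have {}e0 : 0 < complex.Re e by rewrite -ltcR -eE.
near=> x; rewrite distrC eE -rnormE lecR; apply: l2_norm_le; first exact: ltW.
move=> n; under eq_bigr do rewrite l2B vE.
by move: n; near: x; exact: dist_u.
Unshelve. all: by end_near. Qed.

HB.instance Definition _ := Uniform_isComplete.Build l2 l2_complete.

End l2_hilbert.

Section l2_unit.
Variable R : realType.

Lemma l2_unit_subproof (n : nat) :
  (fun k => (k == n)%:R) \in @square_summable R.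
Proof.
apply/square_summableP; apply: nondecreasing_is_cvgn.
  by apply: nondecreasing_series => k _ _; exact: sqr_ge0.
exists 1 => _ [m _ <-]; rewrite /series/=.
have -> : \sum_(0 <= k < m) rnorm ((k == n)%:R : R[i]) ^+ 2 =
    \sum_(0 <= k < m | k == n) 1.
  rewrite [RHS]big_mkcond/=; apply: eq_bigr => k _.
  by rewrite /rnorm normr_nat; case: eqP => _; rewrite ?expr1n ?expr0n.
have [nm|mn] := ltnP n m; last first.
  rewrite big_nat_cond big1// => k /andP[/andP[_ km] /eqP kn].
  by move: km; rewrite kn ltnNge mn.
by rewrite big_mkord (big_pred1 (Ordinal nm)).
Qed.

Definition l2_unit (n : nat) : l2 R := L2 (l2_unit_subproof n).

End l2_unit.

Section families.
Variables (R : realType) (H : innerProductType R).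
Implicit Types u : nat -> H.

Definition linearly_independent u : Prop :=
  forall (s : seq nat) (c : nat -> R[i]), uniq s ->
    \sum_(i <- s) c i *: u i = 0 -> forall i, i \in s -> c i = 0.

Definition orthonormal_family u : Prop :=
  forall i j, inner (u i) (u j) = (i == j)%:R.

Definition linear_span u : set H :=
  [set x | exists (s : seq nat) (c : nat -> R[i]),
     x = \sum_(i <- s) c i *: u i].

Definition orthonormal_basis u : Prop :=
  orthonormal_family u /\ closure (linear_span u) = setT.

End families.

Section operators.
Variable R : realType.
Implicit Types U V : hilbertType R.

Definition bounded_operator U V (T : U -> V) : Prop :=
  exists M : R, forall x, rnorm (T x) <= M * rnorm x.

(* For bounded linear T, the vector z below exists by the Riesz representation
   theorem and is unique, so that the default value 0 is not used. *)
Definition adjoint U V (T : U -> V) (y : V) : U :=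
  xget 0 [set z | forall x, inner (T x) y = inner x z].

(* Over the complex numbers this entails that T is self-adjoint, since
   [0 <= z] in R[i] means that z is real and nonnegative. *)
Definition positive_operator U (T : U -> U) : Prop :=
  forall x, 0 <= inner (T x) x.

(* A positive bounded linear operator has exactly one positive bounded linear
   square root, so that the default value 0 is not used for such operators. *)
Definition operator_sqrt U (T : U -> U) : U -> U :=
  xget 0 [set S | [/\ linear S, bounded_operator S, positive_operator S &
                      S \o S = T]].

Definition modulus U V (T : U -> V) : U -> U :=
  operator_sqrt (adjoint T \o T).

(* The Hilbert-Schmidt norm is computed in the canonical basis of l2; it is the
   same in every orthonormal basis. *)
Definition hs_norm V (T : l2 R -> V) : \bar R :=
  sqrte (\sum_(0 <= k <oo) (rnorm (T (l2_unit R k)) ^+ 2)%:E).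

Definition hilbert_schmidt V (T : l2 R -> V) : Prop :=
  [/\ linear T, bounded_operator T & (hs_norm T < +oo)%E].

End operators.

(* Main.v *)
(* Let [A = |F|], [T = I - A], [g_j = mu_j - f_j], [G = sum |g_j|^2], and let
   [U] be the isometry [e_j |-> mu_j]. If [A x = a x] with [|x| = 1], then
   [|(U - F) x| >= | |U x| - |F x| | = |1 - a| = |T x|], so the inequality would
   be immediate in an eigenbasis of [A]. To avoid infinite-dimensional spectral
   theory, diagonalize the compression of [A] to the span of [e_0 .. e_(n-1)]:
   its eigenvectors are eigenvectors of [A] up to the off-diagonal part of [T],
   whose Hilbert-Schmidt norm tends to 0 as soon as [T] is Hilbert-Schmidt.
   The latter holds because [|T x| <= |(I + A) T x| = |(I - A^2) x|] and
   [<(I - A^2) e_j, e_k> = <g_j, mu_k> + <f_j, g_k>] is square summable.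
   If [G] is infinite there is nothing to prove. The square root [A] of [F^* F]
   is obtained, after scaling, as [I - Y] with [Y] the norm limit of
   [Y_(n+1) = (B + Y_n^2) / 2], where [B = I - F^* F]. *)

Require Import Defs.
From HB Require Import structures.
From mathcomp Require Import all_boot all_order all_algebra.
From mathcomp Require Import sesquilinear spectral complex ring lra.
From mathcomp Require Import boolp classical_sets functions reals ereal.
From mathcomp Require Import topology normedtype sequences.

Set Implicit Arguments.
Unset Strict Implicit.
Unset Printing Implicit Defensive.

Import Order.TTheory GRing.Theory Num.Theory.
Import numFieldNormedType.Exports.

Local Open Scope classical_set_scope.
Local Open Scope complex_scope.
Local Open Scope ring_scope.

(** * The real-valued norm *)

Section rnorm.
Variables (R : realType) (V : normedZmodType R[i]).
Implicit Types x y : V.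

Lemma rnormN x : rnorm (- x) = rnorm x.
Proof. by rewrite /rnorm normrN. Qed.

Lemma rnormB x y : rnorm (x - y) = rnorm (y - x).
Proof. by rewrite -rnormN opprB. Qed.

Lemma rnorm0 : rnorm (0 : V) = 0.
Proof. by rewrite /rnorm normr0. Qed.

Lemma rnorm0_eq0 x : rnorm x = 0 -> x = 0.
Proof. by move=> x0; apply: normr0_eq0; rewrite -rnormE x0. Qed.

End rnorm.

(** * Inner products, Bessel's inequality and unitary combinations *)

Section inner_product.
Variables (R : realType) (H : innerProductType R).
Implicit Types (x y z : H) (a : R[i]).
Local Notation "''[' x , y ]" := (@inner R H x y) : ring_scope.

Lemma innerC x y : '[x, y] = Num.conj '[y, x].
Proof. by rewrite hermC expr0 mul1r. Qed.

Lemma innerxx x : '[x, x] = (rnorm x ^+ 2)%:C.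
Proof. by rewrite rmorphXn/= rnormE sqr_norm_inner. Qed.

Lemma Re_innerxx x : complex.Re '[x, x] = rnorm x ^+ 2.
Proof. by rewrite innerxx. Qed.

Lemma Re_conj a : complex.Re (Num.conj a) = complex.Re a.
Proof. by rewrite conjcE. Qed.

Lemma Re_innerC x y : complex.Re '[x, y] = complex.Re '[y, x].
Proof. by rewrite innerC Re_conj. Qed.

Lemma rnorm_innerC x y : rnorm '[x, y] = rnorm '[y, x].
Proof. by rewrite innerC rnorm_conj. Qed.

Lemma innerDl x y z : '[x + y, z] = '[x, z] + '[y, z].
Proof. exact: linearDl. Qed.

Lemma innerBl x y z : '[x - y, z] = '[x, z] - '[y, z].
Proof. exact: linearBl. Qed.

Lemma innerZl a x z : '[a *: x, z] = a * '[x, z].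
Proof. exact: linearZl_LR. Qed.

Lemma innerDr x y z : '[z, x + y] = '[z, x] + '[z, y].
Proof. exact: linearDr. Qed.

Lemma innerBr x y z : '[z, x - y] = '[z, x] - '[z, y].
Proof. exact: linearBr. Qed.

Lemma innerZr a x z : '[z, a *: x] = Num.conj a * '[z, x].
Proof. exact: linearZr_LR. Qed.

Lemma rnormZ a x : rnorm (a *: x) = rnorm a * rnorm x.
Proof. by apply: complexI; rewrite rmorphM/= !rnormE normrZ. Qed.

Lemma sqr_rnormD x y :
  rnorm (x + y) ^+ 2 = rnorm x ^+ 2 + 2 * complex.Re '[x, y] + rnorm y ^+ 2.
Proof.
rewrite -!Re_innerxx innerDl !innerDr !complexReD (Re_innerC y x).
by rewrite mulr_natl mulr2n !addrA.
Qed.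

Lemma sqr_rnormB x y :
  rnorm (x - y) ^+ 2 = rnorm x ^+ 2 - 2 * complex.Re '[x, y] + rnorm y ^+ 2.
Proof.
rewrite sqr_rnormD rnormN -scaleN1r innerZr rmorphN rmorph1 mulN1r.
by congr (_ + _ + _); case: '[x, y] => a b /=; rewrite mulrN.
Qed.

Lemma rnorm_inner_le x y : rnorm '[x, y] <= rnorm x * rnorm y.
Proof.
rewrite -(ler_pXn2r (n := 2))// ?nnegrE ?mulr_ge0 ?rnorm_ge0//.
rewrite exprMn -lecR [leRHS]rmorphM/= -!innerxx rmorphXn/= rnormE.
exact: dot_CauchySchwarz.
Qed.

Lemma Re_inner_le x y : complex.Re '[x, y] <= rnorm x * rnorm y.
Proof.
apply: le_trans (rnorm_inner_le x y).
exact: le_trans (ler_norm _) (normr_Re_le _).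
Qed.

Lemma inner_suml (I : Type) (r : seq I) (P : pred I) (c : I -> R[i])
    (u : I -> H) z :
  '[\sum_(k <- r | P k) c k *: u k, z] = \sum_(k <- r | P k) c k * '[u k, z].
Proof. by rewrite linear_sumlz; apply: eq_bigr => k _; exact: innerZl. Qed.

Lemma inner_sumr (I : Type) (r : seq I) (P : pred I) (c : I -> R[i])
    (u : I -> H) z :
  '[z, \sum_(k <- r | P k) c k *: u k] =
  \sum_(k <- r | P k) Num.conj (c k) * '[z, u k].
Proof. by rewrite linear_sumr; apply: eq_bigr => k _; exact: innerZr. Qed.

Lemma inner_extr x y : (forall z, '[z, x] = '[z, y]) -> x = y.
Proof.
move=> xy; apply/eqP; rewrite -subr_eq0; apply/eqP/rnorm0_eq0.
apply/eqP; rewrite -sqrf_eq0; apply/eqP; rewrite -Re_innerxx.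
by rewrite innerBr xy subrr.
Qed.

Lemma complexRe_sum (I : Type) (r : seq I) (P : pred I) (z : I -> R[i]) :
  complex.Re (\sum_(k <- r | P k) z k) = \sum_(k <- r | P k) complex.Re (z k).
Proof. by apply: (big_morph (@complex.Re R)) => // a b; exact: complexReD. Qed.

Section orthonormal.
Variables (u : nat -> H) (u_on : orthonormal_family u).

Lemma orthonormal_coord n (c : nat -> R[i]) j :
  '[\sum_(k < n) c k *: u k, u j] = if (j < n)%N then c j else 0.
Proof.
rewrite inner_suml; case: ltnP => jn.
  rewrite (bigD1 (Ordinal jn))//= u_on eqxx mulr1 big1 ?addr0// => k kj.
  rewrite u_on (_ : (k == j :> nat) = false) ?mulr0//.
  by apply: contra_neqF kj => /eqP kj; apply/val_inj.
rewrite big1// => k _; rewrite u_on (_ : (k == j :> nat) = false) ?mulr0//.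
by apply/negP => /eqP kj; have := ltn_ord k; rewrite kj ltnNge jn.
Qed.

Lemma sqr_rnorm_orthonormal n (c : nat -> R[i]) :
  rnorm (\sum_(k < n) c k *: u k) ^+ 2 = \sum_(k < n) rnorm (c k) ^+ 2.
Proof.
rewrite -Re_innerxx inner_sumr complexRe_sum; apply: eq_bigr => k _.
by rewrite orthonormal_coord ltn_ord sqr_rnorm complexReM conjcE/= mulNr opprK.
Qed.

(** Completes the square in each coefficient. The choice [c k = '[x, u k]] gives Bessel's
    inequality; any other choice bounds the Bessel defect by a squared distance to the span. *)
Lemma sqr_rnorm_approx n (c : nat -> R[i]) x :
  rnorm (x - \sum_(k < n) c k *: u k) ^+ 2 = rnorm x ^+ 2
    - \sum_(k < n) rnorm '[x, u k] ^+ 2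
    + \sum_(k < n) rnorm ('[x, u k] - c k) ^+ 2.
Proof.
rewrite sqr_rnormB sqr_rnorm_orthonormal inner_sumr complexRe_sum -addrA.
rewrite -[in RHS]addrA; congr (_ + _).
rewrite mulr_sumr -!sumrN -!big_split; apply: eq_bigr => k _ /=.
rewrite !sqr_rnorm complexReB complexImB complexReM conjcE/=.
by case: '[x, u k] => a b; case: (c k) => p q /=; ring.
Qed.

Lemma Bessel n x : \sum_(k < n) rnorm '[x, u k] ^+ 2 <= rnorm x ^+ 2.
Proof.
have := sqr_rnorm_approx n (fun k => '[x, u k]) x.
rewrite [X in _ = _ + X]big1 => [h|k _]; last by rewrite subrr rnorm0 expr0n.
by rewrite -subr_ge0 -[leRHS]addr0 -h sqr_ge0.
Qed.

End orthonormal.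

(** Expanding the squares leaves the Gram matrix of the columns of [P], which is the identity. The
    family [v] is arbitrary. *)
Lemma unitary_sum_sqr_rnorm n (P : 'M[R[i]]_n) (v : nat -> H) :
  P \is unitarymx ->
  \sum_(i < n) rnorm (\sum_(j < n) P i j *: v j) ^+ 2 =
  \sum_(j < n) rnorm (v j) ^+ 2.
Proof.
move=> Pu; apply: complexI; rewrite !rmorph_sum/=.
under [RHS]eq_bigr do rewrite -innerxx.
have E i : (rnorm (\sum_(j < n) P i j *: v j) ^+ 2)%:C =
    \sum_(j < n) \sum_(k < n) P i j * Num.conj (P i k) * '[v j, v k].
  rewrite -innerxx inner_suml; apply: eq_bigr => j _.
  by rewrite inner_sumr mulr_sumr; apply: eq_bigr => k _; rewrite mulrA.
rewrite (eq_bigr _ (fun i _ => E i)).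
rewrite exchange_big/=; apply: eq_bigr => j _.
rewrite exchange_big/=; under eq_bigr do rewrite -mulr_suml.
(* [unitarymx] speaks of the rows of [P]; passing to [P^T] gives orthonormal columns. *)
have PP k : \sum_(i < n) P i j * Num.conj (P i k) = (j == k)%:R.
  have : (P^T *m map_mx Num.conj P) = 1%:M.
    have : P^T \is unitarymx by rewrite trmx_unitary.
    by move/unitarymxP; rewrite trmxK.
  move/matrixP => /(_ j k); rewrite !mxE => <-.
  by apply: eq_bigr => i _; rewrite !mxE.
under eq_bigr do rewrite PP.
rewrite (bigD1 j)//= eqxx mul1r big1 ?addr0// => k /negPf.
by rewrite eq_sym => ->; rewrite mul0r.
Qed.

End inner_product.

(** * Parseval's identity for orthonormal bases *)

Section parseval.
Variables (R : realType) (H : innerProductType R).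
Local Notation "''[' x , y ]" := (inner x y) : ring_scope.

Definition parseval (u : nat -> H) : Prop := forall x : H,
  (fun n => \sum_(k < n) rnorm '[x, u k] ^+ 2) @ \oo --> rnorm x ^+ 2.

Lemma closure_rnorm (A : set H) (x : H) (eps : R) : closure A x -> 0 < eps ->
  exists2 y, A y & rnorm (x - y) < eps.
Proof.
move=> Ax e0; have /Ax[y [Ay xy]] : nbhs x (ball x eps%:C).
  by apply: nbhsx_ballx; rewrite ltcR.
by exists y => //; move: xy; rewrite -ball_normE/= -rnormE ltcR.
Qed.

(** Indices may repeat in [s], so coefficients of equal indices are added up; [N] exceeds every
    index. *)
Lemma linear_span_ord (u : nat -> H) (x : H) : linear_span u x ->
  exists N, forall n, (N <= n)%N ->
    exists c : nat -> R[i], x = \sum_(k < n) c k *: u k.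
Proof.
move=> [s [c ->]]; exists (\max_(i <- s) i.+1)%N => n sn.
exists (fun k => \sum_(i <- s | i == k) c i).
under [RHS]eq_bigr do rewrite scaler_suml big_mkcond/=.
rewrite exchange_big/= big_seq [RHS]big_seq; apply: eq_bigr => i si.
have ni : (i < n)%N by apply: leq_trans sn; exact: leq_bigmax_seq.
rewrite [RHS](bigD1 (Ordinal ni))//= eqxx big1 ?addr0// => k ki.
case: eqP => // ik; case/eqP: ki; exact/val_inj.
Qed.

(** Density gives a point of the span within [Num.sqrt eps] of [x], and its squared distance to [x]
    bounds the Bessel defect for all large [n]. *)
Lemma orthonormal_basis_parseval (u : nat -> H) :
  orthonormal_basis u -> parseval u.
Proof.
move=> [uon ucl] x; apply/cvgrPdist_le => eps e0.
have : closure (linear_span u) x by rewrite ucl.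
move=> /closure_rnorm/(_ (_ : 0 < Num.sqrt eps))[|y yu xy].
  by rewrite sqrtr_gt0.
have [N yN] := linear_span_ord yu.
exists N => // n /= /yN[c yE].
rewrite ger0_norm ?subr_ge0; last exact: Bessel.
have := sqr_rnorm_approx uon n c x; rewrite -yE => h.
have : rnorm (x - y) ^+ 2 <= eps.
  rewrite -[leRHS]sqr_sqrtr; last exact: ltW.
  rewrite ler_pXn2r ?nnegrE ?rnorm_ge0 ?sqrtr_ge0//.
  exact: ltW.
apply: le_trans; rewrite h lerDl sumr_ge0// => k _; exact: sqr_ge0.
Qed.

Lemma parseval_approx (u : nat -> H) (x : H) :
  orthonormal_family u -> parseval u ->
  (fun n => rnorm (x - \sum_(k < n) '[x, u k] *: u k) ^+ 2) @ \oo --> (0 : R).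
Proof.
move=> uon up.
have -> : (fun n => rnorm (x - \sum_(k < n) '[x, u k] *: u k) ^+ 2) =
    (fun n => rnorm x ^+ 2 - \sum_(k < n) rnorm '[x, u k] ^+ 2).
  apply/funext => n; rewrite (sqr_rnorm_approx uon n (fun k => '[x, u k])).
  rewrite [X in _ + X]big1 ?addr0// => k _.
  by rewrite subrr rnorm0 expr0n.
rewrite -[0 as X in _ --> X](subrr (rnorm x ^+ 2)).
by apply: cvgB; [exact: cvg_cst|exact: up].
Qed.

End parseval.

(** * The canonical basis of [l2] *)

Section canonical_basis.
Variable R : realType.
Local Notation l2 := (l2 R).
Local Notation "''[' x , y ]" := (inner x y) : ring_scope.

Lemma limn_series_single (f : nat -> R) n : (forall k, k != n -> f k = 0) ->
  limn (series f) = f n.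
Proof.
move=> f0; apply/cvg_lim => //; apply: cvg_near_cst.
exists n.+1 => // m /= nm; rewrite /series/= big_mkord.
rewrite (bigD1 (Ordinal nm))//= big1 ?addr0// => k kn.
by apply: f0; apply: contra_neq kn => kn; exact/val_inj.
Qed.

Lemma inner_l2_unit (x : l2) k : '[x, l2_unit R k] = x k.
Proof.
rewrite -[LHS]/(l2_inner x (l2_unit R k)) /l2_inner /csum.
rewrite !(@limn_series_single _ k) => [|j /negPf jk|j /negPf jk] /=.
- by rewrite eqxx rmorph1 mulr1; case: (x k).
- by rewrite jk rmorph0 mulr0.
- by rewrite jk rmorph0 mulr0.
Qed.

Lemma l2_unit_orthonormal : orthonormal_family (l2_unit R).
Proof. by move=> i j; rewrite inner_l2_unit /= eq_sym. Qed.

(** The coefficients are the coordinates, so this is the series that defines the norm. *)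
Lemma l2_unit_parseval : parseval (l2_unit R).
Proof.
move=> x; have /(congr1 (@complex.Re R)) := l2_innerxx x.
rewrite -[l2_inner x x]/('[x, x]) Re_innerxx => -> /=.
have -> : (fun n => \sum_(k < n) rnorm '[x, l2_unit R k] ^+ 2) =
    series (fun k => rnorm (x k) ^+ 2).
  apply/funext => n; rewrite /series/= big_mkord.
  by apply: eq_bigr => k _; rewrite inner_l2_unit.
exact: l2P.
Qed.

End canonical_basis.

(** * Existence of the adjoint *)

Section adjoint.
Variables (R : realType) (H : hilbertType R) (F : {linear l2 R -> H}).
Local Notation "''[' x , y ]" := (inner x y) : ring_scope.

Lemma bounded_operator_gt0 (U V : hilbertType R) (T : U -> V) :
  bounded_operator T ->
  exists2 M : R, 0 < M & forall x, rnorm (T x) <= M * rnorm x.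
Proof.
move=> [M TM]; exists (`|M| + 1) => [|x]; first by rewrite ltr_wpDl.
apply: le_trans (TM x) _; rewrite ler_wpM2r ?rnorm_ge0//.
by rewrite ler_wpDr// ler_norm.
Qed.

(** Riesz representation in coordinates: the functional [phi] is represented by the vector with
    coordinates [Num.conj (phi (u k))]. *)
Lemma adjoint_existence (y : H) : bounded_operator F ->
  exists z, forall x, '[F x, y] = '[x, z].
Proof.
move=> /bounded_operator_gt0[M M0 FM].
pose u := l2_unit R; pose phi x := '[F x, y].
have phi_le x : rnorm (phi x) <= M * rnorm y * rnorm x.
  apply: le_trans (rnorm_inner_le _ _) _.
  by rewrite mulrAC ler_wpM2r ?rnorm_ge0.
have phi_sum n (c : nat -> R[i]) :
    phi (\sum_(k < n) c k *: u k) = \sum_(k < n) c k * phi (u k).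
  rewrite /phi linear_sum -inner_suml.
  by under eq_bigr do rewrite linearZ.
have z2 : (fun k => Num.conj (phi (u k))) \in @square_summable R.
  apply/square_summableP; apply: nondecreasing_is_cvgn.
    by apply: nondecreasing_series => k _ _; exact: sqr_ge0.
  exists ((M * rnorm y) ^+ 2) => _ [n _ <-]; rewrite /series/= big_mkord.
  set s := (X in X <= _).
  (* Here [phi w = |w|^2], so the bound on [phi] yields [|w| <= M |y|]. *)
  pose w := \sum_(k < n) Num.conj (phi (u k)) *: u k.
  have ws : rnorm w ^+ 2 = s.
    by rewrite (sqr_rnorm_orthonormal (@l2_unit_orthonormal R) n
      (fun k => Num.conj (phi (u k)))).
  have s0 : 0 <= s by rewrite -ws sqr_ge0.
  have : rnorm (phi w) = s.
    have -> : phi w = s%:C.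
      rewrite (phi_sum n (fun k => Num.conj (phi (u k)))) rmorph_sum/=.
      apply: eq_bigr => k _.
      by rewrite rmorphXn/= rnormE norm_conjC normCK mulrC.
    by rewrite /rnorm ger0_norm ?lecR.
  move=> pw; have := phi_le w; rewrite pw -ws.
  have [->|w0] := eqVneq (rnorm w) 0; first by rewrite expr0n sqr_ge0.
  have {}w0 : 0 < rnorm w by rewrite lt_neqAle eq_sym w0 rnorm_ge0.
  rewrite [X in X <= _ -> _]expr2 ler_pM2r// => wM.
  by rewrite ler_pXn2r// ?nnegrE ?rnorm_ge0// mulr_ge0 ?rnorm_ge0// ltW.
pose z : l2 R := L2 z2; exists z => x.
have zu k : '[u k, z] = phi (u k) by rewrite innerC inner_l2_unit /= conjCK.
pose C := M * rnorm y + rnorm z.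
pose r n := x - \sum_(k < n) '[x, u k] *: u k.
have C0 : 0 <= C by rewrite addr_ge0 ?mulr_ge0 ?rnorm_ge0// ltW.
(* [phi] and the pairing with [z] agree on the truncations of [x]; only the remainder [r n]
   contributes, and it tends to 0. *)
have le n : rnorm (phi x - '[x, z]) ^+ 2 <= C ^+ 2 * rnorm (r n) ^+ 2.
  have -> : phi x - '[x, z] = phi (r n) - '[r n, z].
    rewrite /r innerBl /phi linearB innerBl -/(phi _) -/(phi _).
    rewrite (phi_sum n (fun k => '[x, u k])) inner_suml.
    under [in RHS]eq_bigr do rewrite -zu.
    by rewrite opprB addrA subrK.
  rewrite -exprMn ler_pXn2r ?nnegrE ?mulr_ge0 ?rnorm_ge0//.
  apply: le_trans (ler_rnormD _ _) _.
  rewrite mulrDl lerD//.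
  by rewrite rnormN mulrC; exact: rnorm_inner_le.
have lim0 : (fun n => C ^+ 2 * rnorm (r n) ^+ 2) @ \oo --> C ^+ 2 * 0.
  apply: cvgMr; apply: parseval_approx; first exact: l2_unit_orthonormal.
  exact: l2_unit_parseval.
have : rnorm (phi x - '[x, z]) ^+ 2 <= C ^+ 2 * 0.
  rewrite -(cvg_lim _ lim0)//; apply: limr_ge.
    by apply/cvg_ex; eexists; exact: lim0.
  exact: nearW.
rewrite mulr0 => h; apply/eqP; rewrite -subr_eq0.
apply/eqP/rnorm0_eq0/eqP.
by rewrite -sqrf_eq0 eq_le h sqr_ge0.
Qed.

Lemma inner_adjoint (x : l2 R) (y : H) : bounded_operator F ->
  '[F x, y] = '[x, adjoint F y].
Proof. by move=> /(adjoint_existence y) h; exact: (xgetPex 0 h). Qed.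

End adjoint.

(** * Linearity rules for functions that are not bundled as linear maps *)

Section linear_prop.
Variables (K : pzRingType) (U V : lmodType K) (Q : U -> V) (lQ : linear Q).

Lemma linear_propD x y : Q (x + y) = Q x + Q y.
Proof. by have := lQ 1 x y; rewrite !scale1r. Qed.

Lemma linear_prop0 : Q 0 = 0.
Proof. by apply: (@addrI _ (Q 0)); rewrite -linear_propD !addr0. Qed.

Lemma linear_propZ a x : Q (a *: x) = a *: Q x.
Proof. by have := lQ a x 0; rewrite linear_prop0 !addr0. Qed.

Lemma linear_propB x y : Q (x - y) = Q x - Q y.
Proof. by rewrite -scaleN1r linear_propD linear_propZ scaleN1r. Qed.

Lemma linear_prop_sum n (c : 'I_n -> K) (u : 'I_n -> U) :
  Q (\sum_(k < n) c k *: u k) = \sum_(k < n) c k *: Q (u k).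
Proof.
rewrite (big_morph Q linear_propD linear_prop0).
by apply: eq_bigr => k _; rewrite linear_propZ.
Qed.

End linear_prop.

(** * Square root of [1 - B] for a self-adjoint contraction [B] *)

Section square_root.
Variables (R : realType) (U : hilbertType R).
Implicit Types (x y z : U) (Q Z : U -> U) (r : R).
Local Notation "''[' x , y ]" := (inner x y) : ring_scope.

Definition self_adjoint Q := forall x y, '[Q x, y] = '[x, Q y].

Lemma self_adjoint_real Q x : self_adjoint Q ->
  '[Q x, x] = (complex.Re '[Q x, x])%:C.
Proof.
move=> /(_ x x) h; have := innerC (Q x) x; rewrite -h conjcE.
case: '[Q x, x] => a b [] /= /eqP; rewrite -subr_eq0 opprK -mulr2n mulrn_eq0/=.
by move=> /eqP ->.
Qed.

(** The increments of [r] majorize those of [v], so [v] is Cauchy; letting [m] go to infinity gives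
    the explicit rate. *)
Lemma rnorm_cauchy_cvg (v : nat -> U) (r : nat -> R) (c : R) :
  nondecreasing_seq r -> cvgn r -> 0 <= c ->
  (forall n m, (n <= m)%N -> rnorm (v m - v n) <= (r m - r n) * c) ->
  exists l, forall n, rnorm (v n - l) <= (limn r - r n) * c.
Proof.
move=> rnd rcvg c0 vr.
have rle n : r n <= limn r by exact: nondecreasing_cvgn_le.
have vr' n m : (n <= m)%N -> rnorm (v m - v n) <= (limn r - r n) * c.
  move=> nm; apply: le_trans (vr _ _ nm) _.
  by rewrite ler_wpM2r// lerB.
have : cvgn v.
  apply/cauchy_cvgP/cauchy_ballP => eps e0.
  have eE : eps = (complex.Re eps)%:C by rewrite RRe_real// gtr0_real.
  have {}e0 : 0 < complex.Re eps by rewrite -ltcR -eE.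
  have [N _ NP] : \forall n \near \oo, (limn r - r n) * c < complex.Re eps / 2.
    have h : (fun n => (limn r - r n) * c) @ \oo --> (limn r - limn r) * c.
      by apply: cvgMl; apply: cvgB; [exact: cvg_cst|].
    rewrite subrr mul0r in h; apply: (cvgr_lt _ h).
    by rewrite divr_gt0.
  have vN : \forall x \near v @ \oo, rnorm (x - v N) < complex.Re eps / 2.
    exists N => // n /= /vr' h; exact: le_lt_trans h (NP N (leqnn N)).
  near=> x y; rewrite /= -ball_normE/= eE -rnormE ltcR.
  have : rnorm (x - v N) < complex.Re eps / 2 by near: x.
  have : rnorm (y - v N) < complex.Re eps / 2 by near: y.
  rewrite (rnormB y); have := ler_rnormD (x - v N) (v N - y).
  rewrite addrA subrK; lra.
move=> /cvg_ex[l vl]; exists l => n; apply/ler_addgt0Pr => eps e0.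
have /cvgrPdist_lt/(_ eps%:C)[|N _ NP] := vl; first by rewrite ltcR.
have := NP (maxn n N) (leq_maxr _ _); rewrite /= -rnormE ltcR => h1.
have := vr' _ _ (leq_maxl n N) => h2.
have := ler_rnormD (v n - v (maxn n N)) (v (maxn n N) - l).
rewrite addrA subrK (rnormB (v n) (v _)) (rnormB (v (maxn _ _)) l); lra.
Unshelve. all: by end_near. Qed.

(** Used to prove identities for a limit operator: the discrepancy [v] is fixed, while its bound
    comes from the [n]-th approximation. *)
Lemma rnorm_le_cvg0 (V : normedZmodType R[i]) (v : V) (d : nat -> R) (c : R) :
  d @ \oo --> (0 : R) -> (forall n, rnorm v <= d n * c) -> v = 0.
Proof.
move=> d0 vd; apply/rnorm0_eq0/eqP; rewrite eq_le rnorm_ge0 andbT.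
have h : (fun n => d n * c) @ \oo --> 0 * c by exact: cvgMl.
rewrite mul0r in h; rewrite -(cvg_lim _ h)//.
by apply: limr_ge; [apply/cvg_ex; exists 0|exact: nearW].
Qed.

Section contraction.
Variables (B : U -> U) (B_linear : linear B) (B_sa : self_adjoint B).
Hypothesis B_le : forall x, rnorm (B x) <= rnorm x.

(* Satisfied by the values [Q] at [B] of the polynomials [p] with nonnegative
   real coefficients, with [r = p(1)]. *)
Definition dominated Q r := [/\ 0 <= r, linear Q,
  forall x, rnorm (Q x) <= r * rnorm x, self_adjoint Q &
  forall Z, linear Z -> (forall x, Z (B x) = B (Z x)) ->
            forall x, Z (Q x) = Q (Z x)].

Lemma dominated0 : dominated (fun=> 0) 0.
Proof.
split=> //.
- by move=> a x y; rewrite scaler0 addr0.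
- by move=> x; rewrite rnorm0 mul0r.
- by move=> x y; rewrite linear0l linear0r.
- by move=> Z lZ _ x; rewrite (linear_prop0 lZ).
Qed.

Lemma dominatedB : dominated B 1.
Proof. by split=> // x; rewrite mul1r. Qed.

Lemma dominatedD Q1 Q2 r1 r2 : dominated Q1 r1 -> dominated Q2 r2 ->
  dominated (fun x => Q1 x + Q2 x) (r1 + r2).
Proof.
move=> [r10 l1 b1 s1 c1] [r20 l2 b2 s2 c2]; split.
- exact: addr_ge0.
- by move=> a x y; rewrite l1 l2 scalerDr addrACA.
- by move=> x; rewrite mulrDl (le_trans (ler_rnormD _ _))// lerD.
- by move=> x y; rewrite innerDl innerDr s1 s2.
- by move=> Z lZ ZB x; rewrite (linear_propD lZ) c1// c2.
Qed.

Lemma dominatedZ Q a r : 0 <= a -> dominated Q r ->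
  dominated (fun x => a%:C *: Q x) (a * r).
Proof.
move=> a0 [r0 l b s c]; split.
- exact: mulr_ge0.
- by move=> k x y; rewrite l scalerDr !scalerA (mulrC k).
- move=> x; rewrite rnormZ -mulrA.
  have -> : rnorm a%:C = a by rewrite /rnorm ger0_norm ?lecR.
  by rewrite ler_wpM2l.
- by move=> x y; rewrite innerZl innerZr s conjcE /= oppr0.
- by move=> Z lZ ZB x; rewrite (linear_propZ lZ) c.
Qed.

(** The commutation clause of [Q1] at [Z := B] shows that [Q1] commutes with [B]; that of [Q2] then
    applies to [Z := Q1]. *)
Lemma dominated_comm Q1 Q2 r1 r2 : dominated Q1 r1 -> dominated Q2 r2 ->
  forall x, Q1 (Q2 x) = Q2 (Q1 x).
Proof.
move=> [_ l1 _ _ c1] [_ _ _ _ c2]; apply: c2 => // x.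
by rewrite (c1 B).
Qed.

Lemma dominatedM Q1 Q2 r1 r2 : dominated Q1 r1 -> dominated Q2 r2 ->
  dominated (fun x => Q1 (Q2 x)) (r1 * r2).
Proof.
move=> d1 d2; have c12 := dominated_comm d1 d2.
move: d1 d2 => [r10 l1 b1 s1 c1] [r20 l2 b2 s2 c2]; split.
- exact: mulr_ge0.
- by move=> a x y; rewrite l2 l1.
- by move=> x; rewrite (le_trans (b1 _))// -mulrA ler_wpM2l.
- by move=> x y; rewrite s1 s2 c12.
- by move=> Z lZ ZB x; rewrite c1// c2.
Qed.

(* [sqrt_iter n] is a polynomial in [B] with nonnegative coefficients, and
   [sqrt_bound n] is the value of this polynomial at 1. *)
Fixpoint sqrt_iter n : U -> U :=
  if n is n'.+1 then
    fun x => (2^-1 : R)%:C *: (B x + sqrt_iter n' (sqrt_iter n' x))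
  else fun=> 0.

Fixpoint sqrt_bound n : R :=
  if n is n'.+1 then 2^-1 * (1 + sqrt_bound n' * sqrt_bound n') else 0.

Local Notation Y := sqrt_iter.
Local Notation r := sqrt_bound.

Lemma half_ge0 : 0 <= 2^-1 :> R. Proof. by rewrite invr_ge0. Qed.

Lemma dominated_sqrt_iter n : dominated (Y n) (r n).
Proof.
elim: n => [|n IH]; first exact: dominated0.
apply: dominatedZ; first exact: half_ge0.
by apply: dominatedD; [exact: dominatedB|exact: dominatedM].
Qed.

(** By commutativity, [Y_(n+2) - Y_(n+1)] is half of [(Y_(n+1) - Y_n)(Y_(n+1) + Y_n)], so the
    increments keep nonnegative coefficients; [r] follows the same recursion. *)
Lemma dominated_sqrt_step n :
  dominated (fun x => Y n.+1 x - Y n x) (r n.+1 - r n).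
Proof.
elim: n => [|n IH].
  have -> : (fun x => Y 1 x - Y 0 x) = (fun x => (2^-1 : R)%:C *: B x).
    by apply/funext => x /=; rewrite subr0 addr0.
  have -> : r 1 - r 0 = 2^-1 * 1 by rewrite /=; ring.
  by apply: dominatedZ; [exact: half_ge0|exact: dominatedB].
have dn := dominated_sqrt_iter n; have dn1 := dominated_sqrt_iter n.+1.
have -> : (fun x => Y n.+2 x - Y n.+1 x) = (fun x => (2^-1 : R)%:C *:
    (Y n.+1 (Y n.+1 x + Y n x) - Y n (Y n.+1 x + Y n x))).
  apply/funext => x.
  have -> : Y n.+2 x = (2^-1 : R)%:C *: (B x + Y n.+1 (Y n.+1 x)) by [].
  have {2}-> : Y n.+1 x = (2^-1 : R)%:C *: (B x + Y n (Y n x)) by [].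
  rewrite -scalerBr; congr (_ *: _).
  have [[_ ln _ _ _] [_ ln1 _ _ _]] := (dn, dn1).
  rewrite (linear_propD ln) (linear_propD ln1) (dominated_comm dn dn1).
  by rewrite opprD addrACA subrr add0r [in RHS]opprD addrA addrK.
have -> : r n.+2 - r n.+1 = 2^-1 * ((r n.+1 - r n) * (r n.+1 + r n)).
  have -> : r n.+2 = 2^-1 * (1 + r n.+1 * r n.+1) by [].
  have {3}-> : r n.+1 = 2^-1 * (1 + r n * r n) by [].
  by ring.
apply: dominatedZ; first exact: half_ge0.
by apply: (dominatedM IH); exact: dominatedD.
Qed.

Lemma sqrt_bound_homo : nondecreasing_seq r.
Proof.
apply/nondecreasing_seqP => n; rewrite -subr_ge0.
by have [] := dominated_sqrt_step n.
Qed.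

Lemma sqrt_bound_le1 n : r n <= 1.
Proof.
elim: n => [|n IH] //=; have [r0 _ _ _ _] := dominated_sqrt_iter n.
nra.
Qed.

Lemma sqrt_bound_cvg : cvgn r.
Proof.
apply: nondecreasing_is_cvgn; first exact: sqrt_bound_homo.
by exists 1 => _ [n _ <-]; exact: sqrt_bound_le1.
Qed.

Lemma sqrt_iter_le n m x : (n <= m)%N ->
  rnorm (Y m x - Y n x) <= (r m - r n) * rnorm x.
Proof.
move=> /subnK <-; move: (m - n)%N => k.
elim: k => [|k IH]; first by rewrite add0n !subrr rnorm0 mul0r.
have [_ _ /(_ x) h _ _] := dominated_sqrt_step (k + n).
have := ler_rnormD (Y (k + n).+1 x - Y (k + n) x) (Y (k + n) x - Y n x).
rewrite addrA subrK addSn; move: h IH; lra.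
Qed.

(** The limit [T] of the iteration satisfies [2 T = B + T^2], hence [(1 - T)^2 = 1 - B]; positivity
    of [1 - T] follows from [|T x| <= |x|]. *)
Lemma positive_sqrt_one_minus : exists S : U -> U,
  [/\ linear S, bounded_operator S, positive_operator S &
      forall x, S (S x) = x - B x].
Proof.
pose d n := limn r - r n.
have d_ge0 n : 0 <= d n.
  rewrite subr_ge0; apply: nondecreasing_cvgn_le; first exact: sqrt_bound_homo.
  exact: sqrt_bound_cvg.
have d_cvg : d @ \oo --> (0 : R).
  rewrite -(subrr (limn r)).
  by apply: cvgB; [exact: cvg_cst|exact: sqrt_bound_cvg].
have d_homo n : d n.+1 <= d n.
  by rewrite lerB//; exact: sqrt_bound_homo.
have /choice[T TP] (x : U) :
    exists l, forall n, rnorm (Y n x - l) <= d n * rnorm x.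
  apply: rnorm_cauchy_cvg; [exact: sqrt_bound_homo|exact: sqrt_bound_cvg|
    exact: rnorm_ge0|].
  by move=> n m; exact: sqrt_iter_le.
have T_linear : linear T.
  move=> a x y; apply/eqP; rewrite -subr_eq0; apply/eqP.
  pose c := rnorm (a *: x + y) + rnorm a * rnorm x + rnorm y.
  apply: (rnorm_le_cvg0 (c := c) d_cvg).
  move=> n; have [_ ln _ _ _] := dominated_sqrt_iter n.
  have -> : T (a *: x + y) - (a *: T x + T y) =
      - (Y n (a *: x + y) - T (a *: x + y)) +
      (a *: (Y n x - T x) + (Y n y - T y)).
    rewrite ln scalerBr opprB (addrACA (a *: Y n x)) addrA -addrA.
    by rewrite -opprD addrA subrK.
  apply: le_trans (ler_rnormD _ _) _; rewrite rnormN.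
  have h1 := TP (a *: x + y) n.
  have h2 := ler_rnormD (a *: (Y n x - T x)) (Y n y - T y).
  have h3 := TP y n; rewrite rnormZ in h2.
  have h4 := ler_wpM2l (rnorm_ge0 a) (TP x n).
  rewrite /c !mulrDr; move: h1 h2 h3 h4; rewrite mulrCA; lra.
have T_sa : self_adjoint T.
  move=> x y; apply/eqP; rewrite -subr_eq0; apply/eqP.
  apply: (rnorm_le_cvg0 (c := 2 * (rnorm x * rnorm y)) d_cvg) => n.
  have [_ _ _ sn _] := dominated_sqrt_iter n.
  have -> : '[T x, y] - '[x, T y] =
      '[x, Y n y - T y] - '[Y n x - T x, y].
    by rewrite innerBl innerBr sn opprB addrCA addrAC subrr add0r.
  apply: le_trans (ler_rnormD _ _) _; rewrite rnormN.
  have h1 := rnorm_inner_le x (Y n y - T y).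
  have h2 := rnorm_inner_le (Y n x - T x) y.
  have h3 := ler_wpM2l (rnorm_ge0 x) (TP y n).
  have h4 := ler_wpM2r (rnorm_ge0 y) (TP x n).
  move: h1 h2 h3 h4; lra.
(* This is the rate at [n = 0], where [Y 0] and [r 0] vanish. *)
have T_le x : rnorm (T x) <= rnorm x.
  have [r0 _ b0 _ _] := dominated_sqrt_iter 0.
  have := TP x 0%N; rewrite /d /= subr0 sub0r rnormN => /le_trans; apply.
  rewrite -[leRHS]mul1r ler_wpM2r ?rnorm_ge0//.
  apply: limr_le; first exact: sqrt_bound_cvg.
  by apply: nearW => n; exact: sqrt_bound_le1.
have T_fix x : T x + T x = B x + T (T x).
  apply/eqP; rewrite -subr_eq0; apply/eqP.
  (* Four error terms, each at most [d n * rnorm x]. *)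
  apply: (rnorm_le_cvg0 (c := 4 * rnorm x) d_cvg) => n.
  have [r0 ln bn _ _] := dominated_sqrt_iter n.
  have h : Y n.+1 x + Y n.+1 x = B x + Y n (Y n x).
    have half2 : 2^-1 + 2^-1 = 1 :> R by lra.
    by rewrite /= -scalerDl -rmorphD half2 rmorph1 scale1r.
  have -> : T x + T x - (B x + T (T x)) =
      (Y n (Y n x - T x) + (Y n (T x) - T (T x)))
      - ((Y n.+1 x - T x) + (Y n.+1 x - T x)).
    rewrite (linear_propB ln) [in RHS]addrA subrK.
    rewrite (addrACA (Y n.+1 x)) h -opprD opprB [RHS]addrC 2!opprD.
    by rewrite -[RHS]addrA [X in _ = _ + X]addrA subrK.
  apply: le_trans (ler_rnormD _ _) _; rewrite rnormN.
  have h1 := ler_rnormD (Y n (Y n x - T x)) (Y n (T x) - T (T x)).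
  have h2 := ler_rnormD (Y n.+1 x - T x) (Y n.+1 x - T x).
  have h3 := TP x n.+1.
  have h4 : d n.+1 * rnorm x <= d n * rnorm x by rewrite ler_wpM2r ?rnorm_ge0.
  have h5 := TP (T x) n.
  have h6 : d n * rnorm (T x) <= d n * rnorm x by rewrite ler_wpM2l.
  have h7 := bn (Y n x - T x).
  have h8 : r n * rnorm (Y n x - T x) <= rnorm (Y n x - T x).
    by rewrite -[leRHS]mul1r ler_wpM2r ?rnorm_ge0// sqrt_bound_le1.
  have h9 := TP x n.
  move: h1 h2 h3 h4 h5 h6 h7 h8 h9; lra.
exists (fun x => x - T x); split.
- by move=> a x y; rewrite T_linear scalerBr addrACA opprD.
- exists 2 => x; apply: le_trans (ler_rnormD _ _) _; rewrite rnormN.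
  by have := T_le x; lra.
- move=> x; rewrite innerBl innerxx (self_adjoint_real x T_sa) -rmorphB lecR.
  rewrite subr_ge0; apply: le_trans (Re_inner_le _ _) _.
  by rewrite expr2 ler_wpM2r ?rnorm_ge0.
- move=> x; rewrite (linear_propB T_linear).
  have -> : B x = T x + T x - T (T x) by rewrite T_fix addrK.
  by rewrite !opprB opprD -addrA [- T x + _]addrCA.
Qed.

End contraction.
End square_root.

(** * Self-adjointness of positive operators *)

Section positive.
Variables (R : realType) (U : hilbertType R).
Local Notation "''[' x , y ]" := (inner x y) : ring_scope.

(** Polarization: the form is real at [x + y] and at [x + i y], which gives the imaginary and the
    real part of the identity. *)
Lemma positive_self_adjoint (A : U -> U) :
  linear A -> positive_operator A -> self_adjoint A.
Proof.
move=> A_lin A_pos x y.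
have im0 z : complex.Im '[A z, z] = 0.
  by have := A_pos z; rewrite lecE => /andP[/eqP].
have := im0 (x + y); have := im0 (x + (0 +i* 1) *: y).
rewrite !(linear_propD A_lin) (linear_propZ A_lin) !innerDl !innerDr.
rewrite !innerZl !innerZr [in '[x, A y]]innerC !complexImD !complexImM !im0.
rewrite !conjcE !complexReM !im0.
case: '[A x, y] => a b; case: '[A y, x] => c d /=.
move=> h1 h2; apply/eqP; rewrite eq_complex/=.
by apply/andP; split; apply/eqP; lra.
Qed.

End positive.

(** * The modulus of [F] *)

Section modulus.
Variables (R : realType) (H : hilbertType R) (F : {linear l2 R -> H}).
Hypothesis F_bounded : bounded_operator F.
Local Notation "''[' x , y ]" := (inner x y) : ring_scope.
Local Notation "F^*" := (adjoint F).

Lemma inner_adjointC y x : '[F^* y, x] = '[y, F x].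
Proof. by rewrite innerC -inner_adjoint// -innerC. Qed.

Lemma adjoint_linear : linear F^*.
Proof.
move=> a x y; apply: inner_extr => z.
by rewrite -inner_adjoint// !innerDr !innerZr !inner_adjoint.
Qed.

Lemma adjoint_le (M : R) : 0 <= M -> (forall x, rnorm (F x) <= M * rnorm x) ->
  forall y, rnorm (F^* y) <= M * rnorm y.
Proof.
move=> M0 FM y; have [->|y0] := eqVneq (rnorm (F^* y)) 0.
  by rewrite mulr_ge0 ?rnorm_ge0.
have {}y0 : 0 < rnorm (F^* y) by rewrite lt_neqAle eq_sym y0 rnorm_ge0.
rewrite -(ler_pM2l y0) -expr2 -Re_innerxx inner_adjointC.
apply: le_trans (Re_inner_le _ _) _.
by rewrite mulrA [leRHS]mulrC ler_wpM2l ?rnorm_ge0// mulrC.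
Qed.

(** After division by [M^2], [F^* F] becomes [1 - B] with [B] a self-adjoint contraction; the root
    of [1 - B] is then multiplied by [M]. *)
Lemma modulus_spec : [/\ linear (modulus F), bounded_operator (modulus F),
  positive_operator (modulus F) &
  forall x, modulus F (modulus F x) = F^* (F x)].
Proof.
(* Once some root exists, the one selected by [xget] has these properties. *)
suff /(xgetPex 0) : exists S : l2 R -> l2 R,
    [/\ linear S, bounded_operator S, positive_operator S &
        S \o S = F^* \o F].
  rewrite -/(operator_sqrt (F^* \o F)) -/(modulus F) => -[? ? ? h].
  by split=> // x; have := congr1 (@^~ x) h.
have [M M0 FM] := bounded_operator_gt0 F_bounded.
have M0' := ltW M0; have Fa_le := adjoint_le M0' FM.
pose c : R := (M ^+ 2)^-1; have c0 : 0 <= c by rewrite invr_ge0 sqr_ge0.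
have cM : c * M ^+ 2 = 1 by rewrite mulVf// expf_neq0// gt_eqF.
pose B x := x - c%:C *: F^* (F x).
have FF_linear : linear (F^* \o F).
  by move=> a x y; rewrite /= linearP adjoint_linear.
have B_linear : linear B.
  move=> a x y; rewrite /B -[F^* _]/((F^* \o F) _) FF_linear/=.
  by rewrite scalerBr scalerDr !scalerA (mulrC c%:C) opprD addrACA.
have B_sa : self_adjoint B.
  move=> x y; rewrite /B innerBl innerBr innerZl innerZr.
  by rewrite inner_adjointC inner_adjoint// conjcE /= oppr0.
(* In the expansion of [|B x|^2] the last term is at most [c |F x|^2], since [c M^2 = 1]; the cross
   term is [- 2 c |F x|^2]. *)
have B_le x : rnorm (B x) <= rnorm x.
  rewrite -(ler_pXn2r (n := 2))// ?nnegrE ?rnorm_ge0// /B sqr_rnormB rnormZ.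
  rewrite innerZr -inner_adjoint// innerxx.
  have -> : rnorm c%:C = c by rewrite /rnorm ger0_norm ?lecR.
  rewrite complexReM !conjcE /= oppr0 mul0r subr0 exprMn.
  have : rnorm (F^* (F x)) ^+ 2 <= M ^+ 2 * rnorm (F x) ^+ 2.
    by rewrite -exprMn ler_pXn2r ?nnegrE ?mulr_ge0 ?rnorm_ge0.
  move=> /(ler_wpM2l c0)/(ler_wpM2l c0).
  rewrite [c * (M ^+ 2 * _)]mulrA cM mul1r mulrA -expr2.
  have := mulr_ge0 c0 (sqr_ge0 (rnorm (F x))); lra.
have [S [S_lin [K SK] S_pos SS]] := positive_sqrt_one_minus B_linear B_sa B_le.
exists (fun x => M%:C *: S x); split.
- by move=> a x y; rewrite S_lin scalerDr !scalerA (mulrC a).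
- exists (M * K) => x; rewrite rnormZ -mulrA.
  have -> : rnorm M%:C = M by rewrite /rnorm ger0_norm ?lecR.
  by rewrite ler_wpM2l.
- by move=> x; rewrite innerZl mulr_ge0// lecR.
- apply/funext => x /=; rewrite (linear_propZ S_lin) SS /B opprB addrC subrK.
  by rewrite !scalerA -!rmorphM -expr2 mulrC cM scale1r.
Qed.

Lemma rnorm_modulus x : rnorm (modulus F x) = rnorm (F x).
Proof.
have [A_lin A_bd A_pos AA] := modulus_spec.
apply/eqP; rewrite -(eqrXn2 (n := 2))// ?rnorm_ge0// -!Re_innerxx.
by rewrite (positive_self_adjoint A_lin A_pos) AA inner_adjoint.
Qed.

End modulus.

(** * Sums of squares of matrix entries *)

Section parseval_sums.
Variables (R : realType) (H : innerProductType R).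
Local Notation "''[' x , y ]" := (inner x y) : ring_scope.

(** Parseval in each [v j] reduces the bound to finite blocks of entries, and only wide blocks
    matter in the limit. *)
Lemma parseval_sum_le (u v : nat -> H) n m0 (C : R) : parseval u ->
  (forall m, (m0 <= m)%N ->
    \sum_(j < n) \sum_(k < m) rnorm '[v j, u k] ^+ 2 <= C) ->
  \sum_(j < n) rnorm (v j) ^+ 2 <= C.
Proof.
move=> up le_C.
have h : (fun m => \sum_(j < n) \sum_(k < m) rnorm '[v j, u k] ^+ 2) @ \oo -->
    \sum_(j < n) rnorm (v j) ^+ 2.
  by apply: cvg_big => [|j _]; [exact: add_continuous|exact: up].
rewrite -(cvg_lim _ h)//; apply: limr_le.
  by apply/cvg_ex; eexists; exact: h.
by exists m0 => // m /=; exact: le_C.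
Qed.

(** Expand [T (u k)] in [e], move [T] to the other side, and apply Bessel in [u]. This carries a
    bound from the given basis to the canonical one of [hs_norm]. *)
Lemma self_adjoint_sum_le (T : H -> H) (e u : nat -> H) (C : R) :
  (forall x y, '[T x, y] = '[x, T y]) -> orthonormal_family u -> parseval e ->
  (forall m, \sum_(j < m) rnorm (T (e j)) ^+ 2 <= C) ->
  forall n, \sum_(k < n) rnorm (T (u k)) ^+ 2 <= C.
Proof.
move=> T_sa uon ep TC n.
apply: (parseval_sum_le (m0 := 0) (v := T \o u) ep) => m _.
rewrite exchange_big/=; apply: le_trans (TC m); apply: ler_sum => j _.
by under eq_bigr do rewrite T_sa rnorm_innerC; exact: Bessel.
Qed.

End parseval_sums.

(** * Comparison of [I - |F|] with [mu - f] along the basis [e] *)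

Section comparison.
Variables (R : realType) (H : hilbertType R) (F : {linear l2 R -> H}).
Hypothesis F_bounded : bounded_operator F.
Variables (e : nat -> l2 R) (mu : nat -> H) (G : R).
Hypotheses (e_on : orthonormal_family e) (e_parseval : parseval e).
Hypothesis mu_on : orthonormal_family mu.
Local Notation "''[' x , y ]" := (inner x y) : ring_scope.
Let g j := mu j - F (e j).
Hypothesis g_le : forall n, \sum_(j < n) rnorm (g j) ^+ 2 <= G.
Let A := modulus F.
Let T x := x - A x.

Let A_lin : linear A. Proof. by have [] := modulus_spec F_bounded. Qed.
Let A_pos : positive_operator A.
Proof. by have [] := modulus_spec F_bounded. Qed.
Let A_sa : self_adjoint A. Proof. exact: positive_self_adjoint. Qed.
Let AA x : A (A x) = adjoint F (F x).
Proof. by rewrite /A; have [_ _ _ ->] := modulus_spec F_bounded. Qed.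

Lemma one_minus_modulus_linear : linear T.
Proof. by move=> a x y; rewrite /T A_lin scalerBr opprD addrACA. Qed.
Let T_lin := one_minus_modulus_linear.

Lemma one_minus_modulus_self_adjoint : self_adjoint T.
Proof. by move=> x y; rewrite /T innerBl innerBr A_sa. Qed.
Let T_sa := one_minus_modulus_self_adjoint.

(* [|y| <= |(I + A) y|] for [y = (I - A) x]. *)
Lemma one_minus_modulus_le x : rnorm (T x) <= rnorm (x - A (A x)).
Proof.
have -> : x - A (A x) = T x + A (T x).
  by rewrite /T (linear_propB A_lin) addrA subrK.
rewrite -(ler_pXn2r (n := 2))// ?nnegrE ?rnorm_ge0//.
rewrite (sqr_rnormD (T x) (A (T x))) -[leRHS]addrA lerDl.
rewrite addr_ge0 ?sqr_ge0// mulr_ge0// Re_innerC.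
by have := A_pos (T x); rewrite lecE => /andP[].
Qed.

(** Both ['[e j, e k]] and ['[mu j, mu k]] are the Kronecker delta; insert ['[F (e j), mu k]]
    between ['[mu j, mu k]] and ['[F (e j), F (e k)]]. *)
Lemma one_minus_square_entry j k :
  '[e j - A (A (e j)), e k] = '[g j, mu k] + '[F (e j), g k].
Proof.
rewrite innerBl AA inner_adjointC// e_on -mu_on /g innerBl innerBr.
by rewrite addrA subrK.
Qed.

Lemma one_minus_modulus_sum_bounded :
  exists C, forall n, \sum_(j < n) rnorm (T (e j)) ^+ 2 <= C.
Proof.
have [M M0 FM] := bounded_operator_gt0 F_bounded.
have Fa_le := adjoint_le F_bounded (ltW M0) FM.
(* From [(a + b)^2 <= 2 a^2 + 2 b^2]: Bessel in [mu] bounds the first part by [G]; Bessel in [e],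
   applied to [F^* (g k)], bounds the second by [M^2 G]. *)
exists (2 * G + 2 * (M ^+ 2 * G)) => n.
apply: (@le_trans _ _ (\sum_(j < n) rnorm (e j - A (A (e j))) ^+ 2)).
  apply: ler_sum => j _; rewrite ler_pXn2r ?nnegrE ?rnorm_ge0//.
  exact: one_minus_modulus_le.
apply: (parseval_sum_le (m0 := 0) (v := fun j => e j - A (A (e j))) e_parseval).
move=> m _.
apply: (@le_trans _ _ (2 * (\sum_(j < n) \sum_(k < m) rnorm '[g j, mu k] ^+ 2) +
    2 * (\sum_(k < m) \sum_(j < n) rnorm '[F (e j), g k] ^+ 2))).
  rewrite [X in _ <= _ + 2 * X]exchange_big/= !mulr_sumr -big_split/=.
  apply: ler_sum => j _; rewrite !mulr_sumr -big_split/=.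
  apply: ler_sum => k _; rewrite one_minus_square_entry.
  have := ler_rnormD '[g j, mu k] '[F (e j), g k].
  have := rnorm_ge0 ('[g j, mu k] + '[F (e j), g k]).
  have := sqr_ge0 (rnorm '[g j, mu k] - rnorm '[F (e j), g k]).
  nra.
apply: lerD; rewrite ler_pM2l//.
  apply: le_trans (g_le n); apply: ler_sum => j _; exact: Bessel.
apply: le_trans (ler_wpM2l (sqr_ge0 M) (g_le m)).
rewrite mulr_sumr; apply: ler_sum => k _.
under eq_bigr do rewrite inner_adjoint// rnorm_innerC.
apply: le_trans (Bessel e_on _ _) _.
rewrite -exprMn ler_pXn2r ?nnegrE ?mulr_ge0 ?rnorm_ge0// ?ltW//.
Qed.

Let h n j := T (e j) - \sum_(k < n) '[T (e j), e k] *: e k.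

(* In an eigenbasis of the compression of [A] to the span of [e 0 .. e n-1],
   [A x] differs from a multiple of [x] only by the off-diagonal part [h], and
   the reverse triangle inequality applies to [|U x - F x|]. *)
Lemma finite_comparison n (t : R) : 0 < t ->
  \sum_(j < n) rnorm (T (e j)) ^+ 2 <=
  (1 + t) * \sum_(j < n) rnorm (g j) ^+ 2 +
  4 * (1 + t^-1) * \sum_(j < n) rnorm (h n j) ^+ 2.
Proof.
move=> t0.
(* The compression of [T], which has the eigenvectors of that of [A]. With this index order, the
   rows of [P] hold their coordinates. *)
pose M := \matrix_(i < n, j < n) '[T (e i), e j].
have M_herm : M \is hermsymmx.
  apply/is_hermitianmxP; rewrite expr0 scale1r; apply/matrixP => i j.
  by rewrite !mxE T_sa innerC.
have /hermitian_normalmx/orthomx_spectralP := M_herm.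
set P := spectralmx M; set d := spectral_diag M => ME.
have Pu : P \is unitarymx := spectral_unitarymx M.
have PM : P *m M = diag_mx d *m P.
  by rewrite {1}ME !mulmxA mulmxV ?mul1mx// unitarymx_unit.
pose comb (V : lmodType R[i]) (v : nat -> V) i := \sum_(j < n) P i j *: v j.
(* All three sums are unchanged by the passage to the eigenvectors, so the inequality can be proved
   term by term. *)
rewrite -(unitary_sum_sqr_rnorm (T \o e) Pu) -(unitary_sum_sqr_rnorm g Pu).
rewrite -(unitary_sum_sqr_rnorm (h n) Pu) !mulr_sumr -big_split/=.
apply: ler_sum => i _.
pose x := comb _ e i; pose hx := comb _ (h n) i.
have TxE : T x = comb _ (T \o e) i by rewrite /x /comb (linear_prop_sum T_lin).
have FxE : F x = comb _ (F \o e) i.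
  by rewrite /x /comb linear_sum; apply: eq_bigr => j _; rewrite linearZ.
have gxE : comb _ g i = comb _ mu i - F x.
  by rewrite FxE /comb -sumrB; apply: eq_bigr => j _; rewrite scalerBr.
have hxE : hx = T x - d 0 i *: x.
  rewrite /hx TxE /comb /h; under eq_bigr do rewrite scalerBr scaler_sumr.
  rewrite sumrB; congr (_ - _); rewrite exchange_big/= scaler_sumr.
  apply: eq_bigr => k _; under eq_bigr do rewrite scalerA.
  rewrite -scaler_suml scalerA; congr (_ *: _).
  have /matrixP/(_ i k) := PM; rewrite mul_diag_mx !mxE => <-.
  by apply: eq_bigr => j _; rewrite mxE.
have norm1 (V : innerProductType R) (u : nat -> V) : orthonormal_family u ->
    rnorm (comb _ u i) = 1.
  move=> uon; apply/eqP; rewrite -(eqrXn2 (n := 2))// ?rnorm_ge0// expr1n.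
  have /matrixP/(_ i i) := unitarymxP Pu; rewrite !mxE eqxx => PP.
  rewrite -Re_innerxx /comb inner_suml.
  rewrite -[1]/(complex.Re (true%:R : R[i])) -PP; apply/eqP; congr complex.Re.
  apply: eq_bigr => j _; rewrite inner_sumr !mxE (bigD1 j)//= big1 => [|k kj].
    by rewrite uon eqxx mulr1 addr0.
  rewrite uon (_ : (j == k :> nat) = false) ?mulr0//.
  by apply/negP => /eqP jk; case/eqP: kj; exact/val_inj.
have x1 : rnorm x = 1 by exact: norm1.
have hx_orth : '[hx, x] = 0.
  rewrite /hx /x /comb inner_suml big1// => j _.
  rewrite inner_sumr big1 ?mulr0// => k _.
  rewrite /h innerBl (orthonormal_coord e_on n (fun k => '[T (e j), e k])).
  by rewrite ltn_ord subrr mulr0.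
have [a a0 aE] : exists2 a : R, 0 <= a & '[A x, x] = a%:C.
  exists (complex.Re '[A x, x]); last exact: self_adjoint_real.
  by have := A_pos x; rewrite lecE => /andP[].
(* Pairing the residual [hx] with [x] identifies the eigenvalue. *)
have dE : d 0 i = (1 - a)%:C.
  have := hx_orth; rewrite hxE innerBl innerZl innerxx x1 expr1n mulr1.
  move/eqP; rewrite subr_eq0 => /eqP <-.
  by rewrite /T innerBl innerxx x1 expr1n aE -rmorphB.
have AxE : A x = a%:C *: x - hx.
  rewrite hxE dE rmorphB/= scalerBl scale1r /T !opprB.
  by rewrite [RHS]addrA [a%:C *: x + _]addrC subrK addrC subrK.
have rR (b : R) : rnorm b%:C = `|b|.
  by apply: complexI; rewrite rnormE normc_def /= expr0n addr0 sqrtr_sqr.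
(* [|F x| = |A x|] is within [|hx|] of [a], and within [|comb _ g i|] of 1. *)
have Fx_ge : a <= rnorm (F x) + rnorm hx.
  rewrite -rnorm_modulus// -/A; have := ler_rnormD (A x) hx.
  by rewrite AxE subrK rnormZ x1 mulr1 rR ger0_norm.
have Fx_le : rnorm (F x) <= a + rnorm hx.
  rewrite -rnorm_modulus// -/A AxE; apply: le_trans (ler_rnormD _ _) _.
  by rewrite rnormN rnormZ x1 mulr1 rR ger0_norm.
have mux1 : rnorm (comb _ mu i) = 1 by exact: norm1.
have gx_ge1 : 1 <= rnorm (comb _ g i) + rnorm (F x).
  by have := ler_rnormD (comb _ g i) (F x); rewrite gxE subrK mux1.
have gx_ge2 : rnorm (F x) <= rnorm (comb _ g i) + 1.
  have := ler_rnormD (comb _ mu i) (- comb _ g i).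
  by rewrite gxE opprB addrC subrK rnormB mux1 addrC.
have Tx_le : rnorm (T x) <= `|1 - a| + rnorm hx.
  have := ler_rnormD (d 0 i *: x) hx.
  by rewrite hxE addrC subrK -hxE dE rnormZ x1 mulr1 rR.
have {}Tx_le : rnorm (T x) <= rnorm (comb _ g i) + 2 * rnorm hx.
  by case: (ler0P (1 - a)) Tx_le => _; lra.
change (rnorm (comb _ (T \o e) i) ^+ 2 <=
  (1 + t) * rnorm (comb _ g i) ^+ 2 + 4 * (1 + t^-1) * rnorm hx ^+ 2).
rewrite -TxE.
set p := rnorm (comb _ g i) in Tx_le *; set q := rnorm hx in Tx_le *.
apply: (@le_trans _ _ ((p + 2 * q) ^+ 2)).
  by rewrite ler_pXn2r ?nnegrE ?addr_ge0 ?mulr_ge0 ?rnorm_ge0.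
rewrite -subr_ge0.
(* Young's inequality with parameter [t], its defect written as a square. *)
have -> : (1 + t) * p ^+ 2 + 4 * (1 + t^-1) * q ^+ 2 - (p + 2 * q) ^+ 2 =
    t^-1 * (t * p - 2 * q) ^+ 2 by field; rewrite gt_eqF.
by rewrite mulr_ge0 ?sqr_ge0// invr_ge0 ltW.
Qed.

(** The left side is the mass of the entries with [j < n <= k]. By symmetry these are the entries
    with the indices exchanged, which Bessel bounds by the tail of the sum of [|T (e j)|^2]. *)
Lemma offdiagonal_le (S : R) n :
  (forall m, \sum_(j < m) rnorm (T (e j)) ^+ 2 <= S) ->
  \sum_(j < n) rnorm (h n j) ^+ 2 <= S - \sum_(j < n) rnorm (T (e j)) ^+ 2.
Proof.
move=> TS.
under eq_bigr do
  rewrite /h (sqr_rnorm_approx e_on n (fun k => '[T (e _), e k])).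
have -> : \sum_(j < n) (rnorm (T (e j)) ^+ 2
      - \sum_(k < n) rnorm '[T (e j), e k] ^+ 2
      + \sum_(k < n) rnorm ('[T (e j), e k] - '[T (e j), e k]) ^+ 2) =
    \sum_(j < n) rnorm (T (e j)) ^+ 2 -
    \sum_(j < n) \sum_(k < n) rnorm '[T (e j), e k] ^+ 2.
  rewrite -sumrB; apply: eq_bigr => j _.
  rewrite [X in _ + X]big1 ?addr0// => k _.
  by rewrite subrr rnorm0 expr0n.
rewrite lerBlDr.
apply: (parseval_sum_le (m0 := n) (v := T \o e) e_parseval) => m /subnKC <-.
move: (m - n)%N => p.
under eq_bigr do rewrite big_split_ord/=.
rewrite big_split/= [leLHS]addrC lerD2r exchange_big/= lerBrDr.
apply: le_trans (TS (n + p)%N); rewrite big_split_ord/= [leLHS]addrC lerD2l.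
apply: ler_sum => k _; under eq_bigr do rewrite T_sa rnorm_innerC.
exact: Bessel.
Qed.

(** The crude bound makes the partial sums [s] converge, so the off-diagonal error vanishes as [m]
    grows with [t] fixed. Only afterwards does [t] tend to 0, because [c] blows up there. *)
Theorem one_minus_modulus_sum_le n : \sum_(j < n) rnorm (T (e j)) ^+ 2 <= G.
Proof.
pose s n := \sum_(j < n) rnorm (T (e j)) ^+ 2.
have [C sC] := one_minus_modulus_sum_bounded.
have s_nd : nondecreasing_seq s.
  apply/nondecreasing_seqP => m.
  by rewrite /s big_ord_recr/= lerDl; exact: sqr_ge0.
have s_cvg : cvgn s.
  by apply: nondecreasing_is_cvgn => //; exists C => _ [m _ <-]; exact: sC.
have s_le m : s m <= limn s by exact: nondecreasing_cvgn_le.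
have G0 : 0 <= G by have := g_le 0; rewrite big_ord0.
have lim_le t : 0 < t -> limn s <= (1 + t) * G.
  move=> t0; pose c := 4 * (1 + t^-1).
  have sub m : s m <= (1 + t) * G + c * (limn s - s m).
    apply: le_trans (finite_comparison m t0) _.
    apply: lerD; first by rewrite ler_pM2l ?addr_gt0.
    by rewrite ler_pM2l ?mulr_gt0 ?addr_gt0 ?invr_gt0//; exact: offdiagonal_le.
  have cvg_rhs : (fun m => (1 + t) * G + c * (limn s - s m)) @ \oo -->
      (1 + t) * G + c * (limn s - limn s).
    apply: cvgD; first exact: cvg_cst.
    by apply: cvgMr; apply: cvgB => //; exact: cvg_cst.
  have -> : (1 + t) * G = limn (fun m => (1 + t) * G + c * (limn s - s m)).
    by rewrite (cvg_lim _ cvg_rhs)// subrr mulr0 addr0.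
  apply: ler_lim => //; first by apply/cvg_ex; eexists; exact: cvg_rhs.
  exact: nearW.
apply: le_trans (s_le n) _; apply/ler_addgt0Pr => eps e0.
have G1 : 0 < G + 1 by rewrite ltr_wpDl.
(* [t = eps / (G + 1)] makes [t G <= eps], also when [G = 0]. *)
apply: le_trans (lim_le (eps / (G + 1)) _) _; first by rewrite divr_gt0.
rewrite mulrDl mul1r lerD2l mulrAC ler_pdivrMr// ler_pM2l// lerDl//.
Qed.

End comparison.

(** * Extended real series and their partial sums *)

Section real_series.
Variables (R : realType) (a : nat -> R).
Hypothesis a_ge0 : forall n, 0 <= a n.

Lemma nneseries_le (C : R) : (forall n, \sum_(k < n) a k <= C) ->
  (\sum_(0 <= k <oo) (a k)%:E <= C%:E)%E.
Proof.
move=> aC; apply: lime_le.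
  by apply: is_cvg_nneseries => n _ _; rewrite lee_fin.
by apply: nearW => n; rewrite sumEFin lee_fin big_mkord.
Qed.

Lemma partial_sum_le_nneseries n : (\sum_(0 <= k <oo) (a k)%:E < +oo)%E ->
  \sum_(k < n) a k <= fine (\sum_(0 <= k <oo) (a k)%:E)%E.
Proof.
move=> a_fin; rewrite -lee_fin fineK; last first.
  by rewrite ge0_fin_numE// nneseries_ge0// => k _ _; rewrite lee_fin.
rewrite -sumEFin -(big_mkord xpredT (fun k => (a k)%:E)).
by apply: nneseries_lim_ge => k _ _; rewrite lee_fin.
Qed.

End real_series.

Theorem proposition3p4 (R : realType) (H : hilbertType R)
    (f : nat -> H) (e : nat -> l2 R) (F : {linear l2 R -> H})
    (f_indep : linearly_independent f) (e_basis : orthonormal_basis e)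
    (Fe : forall i, F (e i) = f i) (F_bounded : bounded_operator F) :
  (hilbert_schmidt (idfun \- modulus F) ->
     forall mu : nat -> H, orthonormal_family mu ->
     (\sum_(0 <= j <oo) (rnorm (mu j - f j) ^+ 2)%:E >=
        hs_norm (idfun \- modulus F)%R ^+ 2)%E) /\
  (forall mu : nat -> H, orthonormal_family mu ->
     (\sum_(0 <= j <oo) (rnorm (mu j - f j) ^+ 2)%:E < +oo)%E ->
     hilbert_schmidt (idfun \- modulus F) /\
     (\sum_(0 <= j <oo) (rnorm (mu j - f j) ^+ 2)%:E >=
        hs_norm (idfun \- modulus F)%R ^+ 2)%E).
Proof.
(* Part (2) yields part (1), whose inequality is trivial when the sum is infinite. *)
suff comparison (mu : nat -> H) : orthonormal_family mu ->
     (\sum_(0 <= j <oo) (rnorm (mu j - f j) ^+ 2)%:E < +oo)%E ->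
     hilbert_schmidt (idfun \- modulus F) /\
     (\sum_(0 <= j <oo) (rnorm (mu j - f j) ^+ 2)%:E >=
        hs_norm (idfun \- modulus F)%R ^+ 2)%E.
  split=> // _ mu mu_on.
  have [fin|] := ltP (\sum_(0 <= j <oo) (rnorm (mu j - f j) ^+ 2)%:E)%E +oo%E.
    by have [] := comparison mu mu_on fin.
  by rewrite leye_eq => /eqP ->; exact: leey.
move=> mu_on sum_fin.
set G := (\sum_(0 <= j <oo) _)%E in sum_fin *.
have G_fin : G \is a fin_num.
  by rewrite ge0_fin_numE// nneseries_ge0// => k _ _; rewrite lee_fin sqr_ge0.
have g_le n : \sum_(j < n) rnorm (mu j - F (e j)) ^+ 2 <= fine G.
  under eq_bigr do rewrite Fe.
  apply: (@partial_sum_le_nneseries _ (fun j => rnorm (mu j - f j) ^+ 2)) => //.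
  by move=> k; exact: sqr_ge0.
have e_parseval := orthonormal_basis_parseval e_basis.
have T_le := one_minus_modulus_sum_le F_bounded e_basis.1 e_parseval mu_on g_le.
have T_sa := one_minus_modulus_self_adjoint F_bounded.
have sum_le : (\sum_(0 <= k <oo)
    (rnorm ((idfun \- modulus F)%R (l2_unit R k)) ^+ 2)%:E <= G)%E.
  rewrite -(fineK G_fin); apply: nneseries_le => [k|n]; first exact: sqr_ge0.
  by apply: (self_adjoint_sum_le T_sa (@l2_unit_orthonormal R) e_parseval).
have sum_ge0 : (0 <= \sum_(0 <= k <oo)
    (rnorm ((idfun \- modulus F)%R (l2_unit R k)) ^+ 2)%:E)%E.
  by apply: nneseries_ge0 => k _ _; rewrite lee_fin sqr_ge0.
split; last by rewrite /hs_norm sqr_sqrte.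
split; first exact: one_minus_modulus_linear.
- have [_ [M AM] _ _] := modulus_spec F_bounded.
  exists (1 + M) => x; rewrite /= mulrDl mul1r.
  by apply: le_trans (ler_rnormD _ _) _; rewrite rnormN lerD2l.
- rewrite /hs_norm ltey_eq sqrte_fin_num// ge0_fin_numE//.
  by rewrite (le_lt_trans sum_le).
Qed.
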